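(* The Lie algebra corresponding to the Fréchet-Lie group $\mathbb X^0_z(\mathbb C)$ of all formal power series $\sum_{n=1}^\infty a_nz^n$ over $\mathbb C$ with $a_1\ne0$ (under composition) can be identified with (i.e. is isomorphic as a Lie algebra to) $(\mathbb X^0(\mathbb C),[\cdot,\cdot])$, where $\mathbb X^0(\mathbb C)$ is the set of all formal power series over $\mathbb C$ with zero constant term and the Lie bracket is $[f,g]=fg'-f'g$.
   Context: $f'$ denotes the formal derivative, and products are Cauchy products of formal power series. $\mathbb X^0_z(\mathbb C)$ is a group under formal substitution $g\circ f=\sum_{k\ge1}b_kf^k$ (for $g=\sum_{k\ge1}b_kz^k$), with identity $z$. It is a Fréchet-Lie group whose manifold structure is given by the single global chart $\sum_{n\ge1}a_nz^n\mapsto(a_1,a_2,\dots)$ onto the open subset $\{a_1\neq0\}$ of the Fréchet space $\mathbb C^{\mathbb N}$ of all complex sequences (product topology). Its Lie algebra is the tangent space at the identity $z$ with the bracket induced from the bracket of left-invariant vector fields. *)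

(* Defs.v *)
From HB Require Import structures.
From mathcomp Require Import all_boot all_order all_algebra complex.
From mathcomp Require Import all_classical all_reals all_analysis.

Set Implicit Arguments.
Unset Strict Implicit.
Unset Printing Implicit Defensive.

Import Order.TTheory GRing.Theory Num.Theory.
Import numFieldNormedType.Exports.

Local Open Scope classical_set_scope.
Local Open Scope ring_scope.

(** * Calculus in locally convex spaces *)

Section Calculus.
Context {K : numFieldType}.

(* The directional derivative of f at x along h exists and equals l.  The
   increment t ranges over K, so over the complex numbers this is complex
   differentiability. *)
Definition has_dderiv {E F : tvsType K} (f : E -> F) (x h : E) (l : F) : Prop :=
  (fun t : K^o => t^-1 *: (f (x + t *: h) - f x)) @ (0 : K^o)^' --> l.

(* Maps of class C^k on U in the sense of Hamilton and Milnor (Michal-Bastiani):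
   C^(k+1) means that Df(x)h exists for all x in U and all h, and that
   (x, h) |-> Df(x)h is C^k on U x E.  Meant for open U. *)
Fixpoint class_C (k : nat) : forall E F : tvsType K, set E -> (E -> F) -> Prop :=
  match k with
  | 0 => fun E F U f => forall x, U x -> {for x, continuous f}
  | k'.+1 => fun E F U f =>
      (forall x, U x -> {for x, continuous f}) /\
      exists2 df : (E * E)%type -> F,
        forall x h, U x -> has_dderiv f x h (df (x, h)) &
        @class_C k' (E * E)%type F (U `*` setT) df
  end.

Definition smooth_on {E F : tvsType K} (U : set E) (f : E -> F) : Prop :=
  forall k, class_C k U f.

End Calculus.

(** * Lie groups with a single global chart *)

Section LieGroup.
Context {K : numFieldType} {E : tvsType K} {T : Type}.

(* The underlying group is the subset [gset] of T; the chart [gchart] maps it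
   onto the subset [gdom] of the model space E, with inverse [gparam]. *)
Record charted_group := ChartedGroup {
  gset : set T;
  gmul : T -> T -> T;
  gone : T;
  gchart : T -> E;
  gparam : E -> T;
  gdom : set E
}.

Variable G : charted_group.

Definition is_group_inverse (inv : T -> T) : Prop :=
  forall g, gset G g ->
    [/\ gset G (inv g), gmul G g (inv g) = gone G & gmul G (inv g) g = gone G].

Definition is_group : Prop :=
  [/\ gset G (gone G),
      forall g h, gset G g -> gset G h -> gset G (gmul G g h),
      forall g h k, gset G g -> gset G h -> gset G k ->
        gmul G g (gmul G h k) = gmul G (gmul G g h) k,
      forall g, gset G g -> gmul G (gone G) g = g /\ gmul G g (gone G) = g &
      exists inv, is_group_inverse inv].

Definition is_global_chart : Prop :=
  [/\ open (gdom G),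
      forall g, gset G g -> gdom G (gchart G g) /\ gparam G (gchart G g) = g &
      forall x, gdom G x -> gset G (gparam G x) /\ gchart G (gparam G x) = x].

Definition is_lie_group : Prop :=
  [/\ is_group, is_global_chart,
      smooth_on (gdom G `*` gdom G)
        (fun p : (E * E)%type => gchart G (gmul G (gparam G p.1) (gparam G p.2))) &
      forall inv, is_group_inverse inv ->
        smooth_on (gdom G) (fun x => gchart G (inv (gparam G x)))].

(* A vector field is given by its principal part E -> E in the chart (only its
   values on [gdom] matter), and the tangent space at any point is E. *)

Definition left_translation (g : T) (x : E) : E :=
  gchart G (gmul G g (gparam G x)).

Definition left_invariant_field (V : E -> E) : Prop :=
  smooth_on (gdom G) V /\
  forall g x, gset G g -> gdom G x ->
    has_dderiv (left_translation g) x (V x) (V (left_translation g x)).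

(* Z = [V, W], that is Z x = DW(x)(V x) - DV(x)(W x): the bracket for which the
   derivation of functions along [V, W] is VW - WV. *)
Definition is_field_bracket (V W Z : E -> E) : Prop :=
  forall x, gdom G x ->
    exists a b, [/\ has_dderiv W x (V x) a, has_dderiv V x (W x) b & Z x = a - b].

(* [br] is the bracket induced on the tangent space at the identity by the
   bracket of left-invariant vector fields.  There is at most one such [br] when
   E is Hausdorff. *)
Definition is_lie_bracket_of (br : E -> E -> E) : Prop :=
  let e := gchart G (gone G) in
  (forall v, exists2 V, left_invariant_field V & V e = v) /\
  (forall V W, left_invariant_field V -> left_invariant_field W ->
     exists Z, [/\ left_invariant_field Z, is_field_bracket V W Z &
                   br (V e) (W e) = Z e]).

End LieGroup.

Arguments charted_group {K} E T.

(** * Lie algebras *)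

Section LieAlgebra.
Context {K : numFieldType}.

Definition is_lie_algebra {V : lmodType K} (A : set V) (br : V -> V -> V) : Prop :=
  [/\ A 0 /\ (forall (c : K) u v, A u -> A v -> A (c *: u + v)),
      forall u v, A u -> A v -> A (br u v),
      forall (c : K) u v w, A u -> A v -> A w ->
        br (c *: u + v) w = c *: br u w + br v w /\
        br w (c *: u + v) = c *: br w u + br w v,
      forall u, A u -> br u u = 0 &
      forall u v w, A u -> A v -> A w ->
        br u (br v w) + br v (br w u) + br w (br u v) = 0].

Definition lie_isomorphic {V W : lmodType K} (bV : V -> V -> V)
    (B : set W) (bW : W -> W -> W) : Prop :=
  exists2 phi : {linear V -> W}, set_bij setT B phi &
    forall u v, phi (bV u v) = bW (phi u) (phi v).

End LieAlgebra.

(** * The space of all sequences, with the product topology *)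

Definition seqspace (K : numFieldType) : Type := nat -> K^o.

Section SeqSpace.
Context (K : numFieldType).

HB.instance Definition _ := GRing.Lmodule.copy (seqspace K) (nat -> K^o).
HB.instance Definition _ :=
  Uniform.copy (seqspace K) (prod_topology (fun _ : nat => K^o)).

Lemma seqspace_cvgP (F : set_system (seqspace K)) (x : seqspace K) :
  Filter F -> (F --> x) <-> (forall n, (fun y : seqspace K => y n) @ F --> x n).
Proof.
move=> FF; split=> [Fx n|Fx].
  apply: cvg_trans (@proj_continuous nat (fun=> K^o) n x).
  by apply: cvg_app.
apply/cvg_sup => n.
have surj : (fun y : seqspace K => y n) @` setT = setT.
  by rewrite eqEsubset; split=> // y _; exists (fun=> y).
apply/(cvg_image _ FF surj) => A /Fx FA; exists ((fun y : seqspace K => y n) @^-1` A) => //.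
by rewrite image_preimage.
Qed.

Let proj_cts (n : nat) : continuous (fun y : seqspace K => y n).
Proof. exact: (@proj_continuous nat (fun=> K^o) n). Qed.

Let seqspace_add : continuous (fun p : seqspace K * seqspace K => p.1 + p.2).
Proof.
move=> p; apply/seqspace_cvgP => n.
have p1 : (fun q : seqspace K * seqspace K => q.1 n) @ p --> p.1 n.
  by apply: (cvg_comp fst (fun y : seqspace K => y n)); [exact: cvg_fst|exact: proj_cts].
have p2 : (fun q : seqspace K * seqspace K => q.2 n) @ p --> p.2 n.
  by apply: (cvg_comp snd (fun y : seqspace K => y n)); [exact: cvg_snd|exact: proj_cts].
exact: cvgD p1 p2.
Qed.

Let seqspace_scale : continuous (fun p : K^o * seqspace K => p.1 *: p.2).
Proof.
move=> p; apply/seqspace_cvgP => n.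
have p1 : (fun q : K^o * seqspace K => q.1) @ p --> p.1 by exact: cvg_fst.
have p2 : (fun q : K^o * seqspace K => q.2 n) @ p --> p.2 n.
  by apply: (cvg_comp snd (fun y : seqspace K => y n)); [exact: cvg_snd|exact: proj_cts].
exact: cvgZ p1 p2.
Qed.

Let seqspace_locally_convex : exists2 B : set_system (seqspace K),
  (forall b, b \in B -> convex_set b) & basis B.
Proof.
pose B := [set b : set (seqspace K) | open b /\ convex_set b].
exists B; first by move=> b /[!inE] -[].
split=> [b []//|x].
pose G : set_system (seqspace K) := [set A | exists2 b, B b /\ b x & b `<=` A].
have GF : Filter G.
  split.
  - by exists setT => //; split=> //; split; [exact: openT|move=> ? ? ? _ _; rewrite inE].
  - move=> P Q [b [[bo bc] bx] bP] [c [[co cc] cx] cQ].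
    exists (b `&` c); last exact: setISS.
    split=> //; split; first exact: openI.
    move=> u v l; rewrite !inE => -[bu cu] [bv cv]; split; apply/set_mem.
      by apply: bc; apply/mem_set.
    by apply: cc; apply/mem_set.
  - by move=> P Q PQ [b ? bP]; exists b => //; exact: subset_trans PQ.
suff Gx : G --> x.
  by move=> A /Gx [b [Bb bx] bA]; exists b.
apply/seqspace_cvgP => n A.
have [D Dc [Do Db]] := @locally_convex K K^o.
move=> /Db [d [Dd dx] dA]; exists ((fun y : seqspace K => y n) @^-1` d); last first.
  by move=> y /dA.
split=> //; split.
  by apply: open_comp => [y _|]; [exact: proj_cts|exact: Do].
move=> u v l; rewrite !inE => du dv; apply/set_mem.
by apply: (Dc d _ (u n) (v n)); apply/mem_set.
Qed.

HB.instance Definition _ :=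
  PreTopologicalNmodule_isTopologicalNmodule.Build (seqspace K) seqspace_add.
HB.instance Definition _ :=
  TopologicalNmodule_isTopologicalLmodule.Build K (seqspace K) seqspace_scale.
HB.instance Definition _ :=
  Uniform_isTvs.Build K (seqspace K) seqspace_locally_convex.

End SeqSpace.

(** * Formal power series *)

(* f : fps K stands for \sum_n (f n) z^n.  The vector space structure is the
   pointwise one; the pointwise product is never used. *)
Notation fps K := (nat -> (K : numFieldType)^o).

Section FPS.
Context {K : numFieldType}.
Implicit Types f g : fps K.

Definition fps_one : fps K := fun n => (n == 0%N)%:R.
Definition fps_z : fps K := fun n => (n == 1%N)%:R.

Definition fps_mul f g : fps K := fun n => \sum_(i < n.+1) f i * g (n - i)%N.

Definition fps_exp f (k : nat) : fps K := iter k (fps_mul f) fps_one.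

Definition fps_deriv f : fps K := fun n => f n.+1 *+ n.+1.

(* The substitution g o f for f without constant term: f^k has no coefficient
   below z^k, so only the terms with k <= n contribute to z^n. *)
Definition fps_comp g f : fps K :=
  fun n => \sum_(k < n.+1) g k * fps_exp f k n.

Definition fps0 : set (fps K) := [set f | f 0%N = 0].

Definition fps_bracket f g : fps K :=
  fps_mul f (fps_deriv g) - fps_mul (fps_deriv f) g.

(* The coordinates of \sum_(n >= 1) a_n z^n are (a_1, a_2, ...), hence the shift
   of indices. *)
Definition fps_group : charted_group (seqspace K) (fps K) := {|
  gset := [set f | f 0%N = 0 /\ f 1%N != 0];
  gmul := fps_comp;
  gone := fps_z;
  gchart := fun f => (fun n => f n.+1) : seqspace K;
  gparam := fun a n => if n is m.+1 then a m else 0;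
  gdom := [set a | a 0%N != 0]
|}.

End FPS.

Arguments fps_group K : clear implicits.
Arguments fps0 K : clear implicits.

(* Main.v *)
Require Import Defs.
From HB Require Import structures.
From mathcomp Require Import all_boot all_order all_algebra complex.
From mathcomp Require Import all_classical all_reals all_analysis.
From mathcomp Require Import ring.

(** The coefficients of a product, a derivative or a composite of power series
    without constant term are polynomials in finitely many coefficients of the
    arguments. The coefficients of the compositional inverse of f are
    determined recursively by division by powers of the linear coefficient of
    f, hence are rational functions that are defined wherever it is nonzero.
    Since the model space carries the product topology, a map into it is smooth
    as soon as its coordinates are such rational functions
    ([rational_smooth_on]); this makes the invertible series a Lie group
    ([fps_is_lie_group]). The identities between power series behind the group
    laws, including the chain rule, follow from those for polynomials, because
    each coefficient depends only on truncations of the arguments.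

    Left translation by g is h |-> g o h, with differential k |-> (g' o h) k. By
    the chain rule the left-invariant field with value v at z is h |-> h' v
    ([invariant_field_left_invariant], [left_invariant_fieldE]). It is linear
    in h, so the bracket of the fields of v and w is
    h |-> (h' v)' w - (h' w)' v = h' (v' w - v w') ([invariant_field_bracket]).
    At h = z this is v' w - v w', the opposite of the bracket [v, w] = v w' - v' w.
    Every Lie algebra is isomorphic to its opposite by v |-> - v, which gives the
    isomorphism ([coord_bracket_isomorphic]) and, along it, the Lie algebra
    axioms on the tangent space ([lie_algebra_pullback]). *)

Set Implicit Arguments.
Unset Strict Implicit.
Unset Printing Implicit Defensive.

Import Order.TTheory GRing.Theory Num.Theory.
Import numFieldNormedType.Exports.

Local Open Scope classical_set_scope.
Local Open Scope ring_scope.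

(** * Power series as limits of polynomials *)

Section Truncation.
Context {K : numFieldType}.
Implicit Types (f g h : fps K) (p q : {poly K}).

Definition trunc (N : nat) f : {poly K} := \poly_(i < N) f i.

Lemma coef_trunc N f n : (n < N)%N -> (trunc N f)`_n = f n.
Proof. by move=> nN; rewrite coef_poly nN. Qed.

Definition eq_below (N : nat) p q := forall n, (n < N)%N -> p`_n = q`_n.

Lemma eq_belowM N p p' q q' :
  eq_below N p p' -> eq_below N q q' -> eq_below N (p * q) (p' * q').
Proof.
move=> pp qq n nN; rewrite !coefM; apply: eq_bigr => i _.
rewrite pp ?qq //; last by rewrite (leq_ltn_trans _ nN) // -ltnS.
by rewrite (leq_ltn_trans (leq_subr _ _) nN).
Qed.

Lemma eq_belowX N p q k : eq_below N p q -> eq_below N (p ^+ k) (q ^+ k).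
Proof.
by move=> pq; elim: k => [|k IH] //; rewrite !exprS; apply: eq_belowM.
Qed.

Lemma coef_exp_lt p k n : p`_0 = 0 -> (n < k)%N -> (p ^+ k)`_n = 0.
Proof.
move=> p0 nk; have /factor_theorem[q ->] : root p 0.
  by rewrite /root -[p.[0]]/(p.[0]) horner_coef0 p0.
by rewrite subr0 exprMn coefMXn nk.
Qed.

(** Since [q] has no constant term, [q ^+ k] starts in degree [k]; this is what
    makes the truncated sum defining the substitution of power series agree
    with the composition of polynomials. *)
Lemma coef_comp_below p q n N : q`_0 = 0 -> (n < N)%N ->
  (p \Po q)`_n = \sum_(k < N) p`_k * (q ^+ k)`_n.
Proof.
move=> q0 nN; rewrite comp_polyE coef_sum.
transitivity (\sum_(k < maxn N (size p)) p`_k * (q ^+ k)`_n).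
  rewrite (big_ord_widen _ (fun k => (p`_k *: q ^+ k)`_n) (leq_maxr N (size p))).
  rewrite big_mkcond; apply: eq_bigr => i _; rewrite coefZ.
  by case: ltnP => // le; rewrite nth_default // mul0r.
rewrite (big_ord_widen _ (fun k => p`_k * (q ^+ k)`_n) (leq_maxl N (size p))).
rewrite [RHS]big_mkcond; apply: eq_bigr => i _.
by case: ltnP => // le; rewrite coef_exp_lt ?mulr0 // (leq_trans nN).
Qed.

Lemma eq_below_comp N p p' q q' : q`_0 = 0 -> q'`_0 = 0 ->
  eq_below N p p' -> eq_below N q q' -> eq_below N (p \Po q) (p' \Po q').
Proof.
move=> q0 q0' pp qq n nN; rewrite !(coef_comp_below _ _ nN) //.
by apply: eq_bigr => i _; rewrite pp // (eq_belowX _ qq).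
Qed.

Lemma trunc_fps_mul N f g :
  eq_below N (trunc N (fps_mul f g)) (trunc N f * trunc N g).
Proof.
move=> n nN; rewrite coef_trunc // coefM; apply: eq_bigr => i _.
rewrite !coef_trunc //; last by rewrite (leq_ltn_trans _ nN) // -ltnS.
by rewrite (leq_ltn_trans (leq_subr _ _) nN).
Qed.

Lemma trunc_fps_exp N f k : eq_below N (trunc N (fps_exp f k)) (trunc N f ^+ k).
Proof.
elim: k => [|k IH] n nN; first by rewrite coef_trunc // expr0 coef1.
rewrite trunc_fps_mul // exprS.
exact: (@eq_belowM N _ (trunc N f) _ (trunc N f ^+ k)).
Qed.

Lemma coef0_trunc N f : f 0%N = 0 -> (trunc N f)`_0 = 0.
Proof. by move=> f0; rewrite coef_poly f0 if_same. Qed.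

Lemma trunc_fps_comp N g f : f 0%N = 0 ->
  eq_below N (trunc N (fps_comp g f)) (trunc N g \Po trunc N f).
Proof.
move=> f0 n nN; rewrite coef_trunc // (@coef_comp_below _ _ _ n.+1) //; last first.
  exact: coef0_trunc.
apply: eq_bigr => k _; rewrite coef_trunc ?(leq_ltn_trans _ nN) -1?ltnS //.
by rewrite -trunc_fps_exp // coef_trunc.
Qed.

Lemma trunc_deriv N f : trunc N (fps_deriv f) = (trunc N.+1 f)^`().
Proof.
by apply/polyP => n; rewrite coef_deriv !coef_poly ltnS; case: ifP; rewrite ?mul0rn.
Qed.

(** The principle by which identities between polynomials pass to power
    series: it suffices to verify them on truncations of every order. *)
Lemma fps_eq_trunc f g :
  (forall N, eq_below N (trunc N f) (trunc N g)) -> f = g.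
Proof.
by move=> fg; apply/funext => n; have := fg n.+1 n (ltnSn n); rewrite !coef_trunc.
Qed.

Lemma fps_mulC f g : fps_mul f g = fps_mul g f.
Proof.
apply: fps_eq_trunc => N n nN; rewrite !trunc_fps_mul //.
by rewrite mulrC.
Qed.

Lemma fps_mulA f g h : fps_mul f (fps_mul g h) = fps_mul (fps_mul f g) h.
Proof.
apply: fps_eq_trunc => N n nN; rewrite !trunc_fps_mul //.
rewrite (eq_belowM (fun _ _ => erefl) (@trunc_fps_mul N g h)) //.
by rewrite [RHS](eq_belowM (@trunc_fps_mul N f g) (fun _ _ => erefl)) // mulrA.
Qed.

Lemma fps_mul1 f : fps_mul fps_one f = f.
Proof.
apply/funext => n; rewrite /fps_mul (bigD1 ord0) //= mul1r subn0 big1 ?addr0 //.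
by move=> i; rewrite /fps_one -val_eqE /= => /negbTE->; rewrite mul0r.
Qed.

Lemma fps_mulDl f g h : fps_mul (f + g) h = fps_mul f h + fps_mul g h.
Proof.
apply/funext => n; rewrite [RHS]/GRing.add /= -big_split; apply: eq_bigr => i _.
exact: mulrDl.
Qed.

End Truncation.

(** * The differential ring of power series, and substitution *)

(** A copy of the sequences on which multiplication can be the Cauchy product
    without competing with the pointwise product of functions. *)
Definition ps (K : numFieldType) : Type := nat -> K^o.

Section Ring.
Context (K : numFieldType).

HB.instance Definition _ := GRing.Lmodule.copy (ps K) (nat -> K^o).

Let one_neq0 : (fps_one : ps K) != 0.
Proof.
by apply/eqP => /(congr1 (fun f : fps K => f 0%N)) /eqP; rewrite /fps_one oner_eq0.
Qed.

HB.instance Definition _ := GRing.Zmodule_isComNzRing.Build (ps K)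
  (@fps_mulA K) (@fps_mulC K) (@fps_mul1 K) (@fps_mulDl K) one_neq0.

Implicit Types f g h : ps K.
Local Notation D := (fps_deriv : ps K -> ps K).

Lemma fps_derivB f g : D (f - g) = D f - D g.
Proof. by apply/funext => n; exact: mulrnBl. Qed.

Lemma fps_derivD f g : D (f + g) = D f + D g.
Proof. by apply/funext => n; exact: mulrnDl. Qed.

Lemma fps_derivM f g : D (f * g) = D f * g + f * D g.
Proof.
apply: fps_eq_trunc => N n nN.
rewrite trunc_deriv coef_deriv trunc_fps_mul // -coef_deriv derivM coefD -!trunc_deriv.
rewrite coef_trunc //.
have E M u : (M >= N)%N -> eq_below N (trunc M u) (trunc N (u : ps K)).
  by move=> NM m mN; rewrite !coef_trunc // (leq_trans mN).
rewrite (eq_belowM (fun _ _ => erefl) (E N.+1 _ _)) //.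
rewrite [X in _ + X](eq_belowM (E N.+1 _ _) (fun _ _ => erefl)) //.
by rewrite -!trunc_fps_mul // !coef_trunc.
Qed.

Lemma fps_comp_wide g f n N : f 0%N = 0 -> (n < N)%N ->
  fps_comp g f n = \sum_(k < N) g k * fps_exp f k n.
Proof.
move=> f0 nN.
have := @trunc_fps_comp K N g f f0 n nN; rewrite coef_trunc // => ->.
rewrite (@coef_comp_below _ _ _ n N) ?coef0_trunc //.
by apply: eq_bigr => k _; rewrite coef_trunc // -trunc_fps_exp // coef_trunc.
Qed.

Lemma fps_mulr1 f : fps_mul f fps_one = f.
Proof. exact: (@mulr1 (ps K)). Qed.

Lemma fps_comp0 g f : g 0%N = 0 -> fps_comp g f 0%N = 0.
Proof. by move=> g0; rewrite /fps_comp big_ord1 g0 mul0r. Qed.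

Lemma fps_comp1 g f : f 0%N = 0 -> fps_comp g f 1%N = g 1%N * f 1%N.
Proof.
move=> f0; rewrite /fps_comp !big_ord_recl big_ord0 addr0 /=.
by rewrite fps_mulr1 {1}/fps_one /= mulr0 add0r.
Qed.

Lemma fps_compA k g f : g 0%N = 0 -> f 0%N = 0 ->
  fps_comp k (fps_comp g f) = fps_comp (fps_comp k g) f.
Proof.
move=> g0 f0; apply: fps_eq_trunc => N n nN.
rewrite !trunc_fps_comp ?fps_comp0 //.
rewrite (eq_below_comp _ _ (fun _ _ => erefl) (@trunc_fps_comp K N g f f0)) //; last 2 first.
- by rewrite coef0_trunc ?fps_comp0.
- by rewrite -(trunc_fps_comp g f0) ?(leq_ltn_trans _ nN) // coef0_trunc ?fps_comp0.
rewrite comp_polyA.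
by rewrite [RHS](eq_below_comp _ _ (@trunc_fps_comp K N k g g0) (fun _ _ => erefl))
  ?coef0_trunc.
Qed.

Lemma fps_deriv_comp g f : f 0%N = 0 ->
  D (fps_comp g f) = (fps_comp (D g) f : ps K) * D f.
Proof.
move=> f0; apply: fps_eq_trunc => N n nN.
rewrite trunc_deriv coef_deriv trunc_fps_comp // -coef_deriv deriv_comp -!trunc_deriv.
rewrite trunc_fps_mul //; apply: (eq_belowM _ _ nN) => // m mN.
rewrite trunc_fps_comp //; apply: eq_below_comp (fun _ _ => erefl) _ _ mN; rewrite ?coef0_trunc //.
by move=> i iN; rewrite !coef_trunc // ltnW.
Qed.

Lemma fps_comp_zl f : f 0%N = 0 -> fps_comp fps_z f = f.
Proof.
move=> f0; apply/funext => n.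
rewrite (@fps_comp_wide _ _ _ n.+2) // !big_ord_recl big1 => [|i _].
  by rewrite /fps_z /= mul0r mul1r addr0 add0r fps_mulr1.
by rewrite /fps_z /= mul0r.
Qed.

Lemma fps_comp_zr g : fps_comp g fps_z = g.
Proof.
apply: fps_eq_trunc => N n nN; rewrite trunc_fps_comp //.
case: N nN => // -[|N] nN.
  rewrite (@coef_comp_below _ _ _ n 1) ?coef0_trunc // big_ord1 expr0 coef1.
  by case: n nN => // _; rewrite mulr1.
suff -> : trunc N.+2 fps_z = 'X :> {poly K} by rewrite comp_polyXr.
apply/polyP => i; rewrite coefX coef_poly; case: ifP => //.
by case: i => [|[]].
Qed.

Lemma fps_exp_diag f n : f 0%N = 0 -> fps_exp f n n = f 1%N ^+ n.
Proof.
move=> f0; elim: n => // n IH.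
rewrite /fps_exp /= -/(fps_exp f n) /fps_mul 2!big_ord_recl /= f0 mul0r add0r.
rewrite /bump /= subSS subn0 IH -exprS big1 ?addr0 // => i _.
have lt_n : (n.+1 - bump 0 (bump 0 i) < n)%N.
  by rewrite /bump /= !add1n subSS ltn_subrL /= (leq_ltn_trans _ (ltn_ord i)).
rewrite -(@coef_trunc _ n (fps_exp f n)) // trunc_fps_exp //.
by rewrite coef_exp_lt ?mulr0 ?coef0_trunc.
Qed.

End Ring.

(** * The substitution group *)

Section SubstitutionGroup.
Context {K : numFieldType}.
Implicit Types f g h : fps K.

(** Comparing coefficients of z^n in g o f = z gives
    g_n f_1^n = [n = 1] - \sum_(k < n) g_k (f^k)_n, because (f^n)_n = f_1^n; the
    list collects the coefficients already determined by this recursion. *)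
Fixpoint fps_linv_seq f (n : nat) : seq K :=
  if n is m.+1 then
    let s := fps_linv_seq f m in
    rcons s ((fps_z m - \sum_(k < m) s`_k * fps_exp f k m) / f 1%N ^+ m)
  else [::].

Definition fps_linv f : fps K := fun n => (fps_linv_seq f n.+1)`_n.

Lemma fps_linvE f n :
  fps_linv f n =
  (fps_z n - \sum_(k < n) fps_linv f k * fps_exp f k n) / f 1%N ^+ n.
Proof.
have size_s m : size (fps_linv_seq f m) = m by elim: m => //= m IH; rewrite size_rcons IH.
have nth_s k m : (k < m)%N -> (fps_linv_seq f m)`_k = fps_linv f k.
  elim: m => // m IH; rewrite ltnS leq_eqVlt => /predU1P[->//|km] /=.
  by rewrite nth_rcons size_s km IH.
rewrite {1}/fps_linv /= nth_rcons size_s ltnn eqxx.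
by congr ((_ - _) / _); apply: eq_bigr => k _; rewrite nth_s.
Qed.

Lemma fps_comp_linv f : f 0%N = 0 -> f 1%N != 0 -> fps_comp (fps_linv f) f = fps_z.
Proof.
move=> f0 f1; apply/funext => n; rewrite /fps_comp big_ord_recr /= fps_exp_diag //.
by rewrite fps_linvE divfK ?expf_neq0 // addrC subrK.
Qed.

Lemma gset_fps_linv f : gset (fps_group K) f -> gset (fps_group K) (fps_linv f).
Proof.
move=> [f0 f1]; split; first by rewrite fps_linvE big_ord0 subr0 /fps_z mul0r.
have := congr1 (fun u : fps K => u 1%N) (fps_comp_linv f0 f1).
rewrite fps_comp1 // => E; apply/eqP => g1; move/eqP: E.
by rewrite g1 mul0r /fps_z eq_sym oner_eq0.
Qed.

(** In a monoid where every element has a left inverse, left inverses are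
    two-sided. *)
Lemma fps_linv_comp f : gset (fps_group K) f -> fps_comp f (fps_linv f) = fps_z.
Proof.
move=> Sf; have [f0 f1] := Sf; have Sg := gset_fps_linv Sf; have [g0 g1] := Sg.
have [h0 _] := gset_fps_linv Sg.
suff fE : fps_linv (fps_linv f) = f by rewrite -{1}fE fps_comp_linv.
rewrite -[RHS](fps_comp_zl f0) -(fps_comp_linv g0 g1) -fps_compA //.
by rewrite fps_comp_linv // fps_comp_zr.
Qed.

Lemma fps_is_group_inverse : is_group_inverse (fps_group K) fps_linv.
Proof.
move=> f Sf; have [f0 f1] := Sf.
by split; [exact: gset_fps_linv|exact: fps_linv_comp|exact: fps_comp_linv].
Qed.

Lemma fps_group_inverse_uniq inv f :
  is_group_inverse (fps_group K) inv -> gset (fps_group K) f -> inv f = fps_linv f.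
Proof.
move=> invP Sf; have [[i0 _] /= fi _] := invP f Sf.
have [f0 f1] := Sf; have [g0 _] := gset_fps_linv Sf.
by rewrite -[LHS](fps_comp_zl i0) -(fps_comp_linv f0 f1) -fps_compA // fi fps_comp_zr.
Qed.

Lemma fps_is_group : is_group (fps_group K).
Proof.
split.
- by split=> /=; rewrite /fps_z //= oner_eq0.
- move=> g f [g0 g1] [f0 f1]; split=> /=; first exact: fps_comp0.
  by rewrite fps_comp1 // mulf_neq0.
- by move=> k g f _ [g0 _] [f0 _]; exact: fps_compA.
- by move=> f [f0 _] /=; rewrite fps_comp_zl ?fps_comp_zr.
- by exists fps_linv; exact: fps_is_group_inverse.
Qed.

End SubstitutionGroup.

(** * Directional derivatives of scalar functions *)

Section DirectionalDerivatives.
Context {K : numFieldType} {E : tvsType K}.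
Implicit Types (f g : E -> K^o) (x h : E).

Lemma has_dderiv_cst (c : K^o) x h : has_dderiv (fun _ : E => c) x h 0.
Proof.
rewrite /has_dderiv; apply: cvg_near_cst.
by apply: nearW => t; rewrite subrr scaler0.
Qed.

Lemma has_dderiv_linear f x h :
  (forall c u v, f (c *: u + v) = c * f u + f v) -> has_dderiv f x h (f h).
Proof.
move=> fL; rewrite /has_dderiv; apply: cvg_near_cst.
near=> t; have t0 : t != 0 by near: t; exact: nbhs_dnbhs_neq.
by rewrite [x + _]addrC fL addrK [_ *: _]mulKf.
Unshelve. all: by end_near. Qed.

Lemma has_dderivD f g x h a b :
  has_dderiv f x h a -> has_dderiv g x h b ->
  has_dderiv (fun y => f y + g y) x h (a + b).
Proof.
move=> fa gb; rewrite /has_dderiv.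
rewrite [X in X @ _](_ : _ = (fun t : K^o => t^-1 *: (f (x + t *: h) - f x)) \+
  (fun t : K^o => t^-1 *: (g (x + t *: h) - g x))); last first.
  by apply/funext => t /=; rewrite -scalerDr opprD addrACA.
exact: cvgD.
Qed.

Lemma has_dderiv_cvg f x h a : has_dderiv f x h a ->
  (fun t : K^o => f (x + t *: h)) @ (0 : K^o)^' --> f x.
Proof.
move=> fa.
have t0 : (fun t : K^o => t) @ (0 : K^o)^' --> (0 : K^o) by exact: nbhs_dnbhs.
have : (fun t : K^o => t * (t^-1 *: (f (x + t *: h) - f x)) + f x) @ (0 : K^o)^'
    --> (0 * a + f x : K^o).
  by apply: cvgD (cvg_cst _); apply: cvgM.
rewrite mul0r add0r => H; refine (cvg_trans (near_eq_cvg _) H); near=> t.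
have t1 : t != 0 by near: t; exact: nbhs_dnbhs_neq.
by rewrite /= [_ *: _]/(_ * _) mulVKf // subrK.
Unshelve. all: by end_near. Qed.

Lemma has_dderivM f g x h a b :
  has_dderiv f x h a -> has_dderiv g x h b ->
  has_dderiv (fun y => f y * g y) x h (a * g x + f x * b).
Proof.
move=> fa gb; rewrite /has_dderiv.
have H : (fun t : K^o => (t^-1 *: (f (x + t *: h) - f x)) * g (x + t *: h) +
    f x * (t^-1 *: (g (x + t *: h) - g x))) @ (0 : K^o)^' --> a * g x + f x * b.
  apply: cvgD; apply: cvgM => //; [exact: has_dderiv_cvg gb|exact: cvg_cst].
refine (cvg_trans (near_eq_cvg _) H); apply: nearW => t.
rewrite /= /GRing.scale /=; ring.
Qed.

(** The difference quotient of 1/f is -(f(x + th) - f(x))/t divided by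
    f(x + th) f(x); the first factor in the denominator is nonzero for small t
    because f is continuous along the line. *)
Lemma has_dderivV f x h a : f x != 0 -> has_dderiv f x h a ->
  has_dderiv (fun y => (f y)^-1) x h (- (a * ((f x)^-1 * (f x)^-1))).
Proof.
move=> fx0 fa; rewrite /has_dderiv.
have ft := has_dderiv_cvg fa.
have H : (fun t : K^o => - ((t^-1 *: (f (x + t *: h) - f x)) *
    ((f (x + t *: h))^-1 * (f x)^-1))) @ (0 : K^o)^'
    --> - (a * ((f x)^-1 * (f x)^-1)).
  by apply: cvgN; apply: cvgM => //; apply: cvgM; [exact: cvgV|exact: cvg_cst].
refine (cvg_trans (near_eq_cvg _) H); near=> t.
have t0 : t != 0 by near: t; exact: nbhs_dnbhs_neq.
have t1 : f (x + t *: h) != 0.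
  near: t; exact: (cvgr_neq0 _ ft).
rewrite /= /GRing.scale /=; field.
by rewrite t0 t1 fx0.
Unshelve. all: by end_near. Qed.

Lemma has_dderiv_sum (I : Type) (r : seq I) (f : I -> E -> K^o) (l : I -> K^o) (x h : E) :
  (forall i, has_dderiv (f i) x h (l i)) ->
  has_dderiv (fun y => \sum_(i <- r) f i y) x h (\sum_(i <- r) l i).
Proof.
move=> fl; elim: r => [|i r IH].
  rewrite big_nil (_ : (fun _ => _) = fun=> 0); first exact: has_dderiv_cst.
  by apply/funext => y; rewrite big_nil.
rewrite big_cons (_ : (fun _ => _) = fun y => f i y + \sum_(j <- r) f j y).
  exact: has_dderivD.
by apply/funext => y; rewrite big_cons.
Qed.

Lemma has_dderiv_uniq (f : E -> K^o) (x h : E) l l' :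
  has_dderiv f x h l -> has_dderiv f x h l' -> l = l'.
Proof. by move=> fl fl'; exact: (cvg_unique (@norm_hausdorff K K^o) fl fl'). Qed.

(** The derivative only sees the points x + th with t small, which stay in the
    open set. *)
Lemma has_dderiv_congr {F : tvsType K} (U : set E) (f g : E -> F) (x h : E) l :
  open U -> U x -> (forall y, U y -> f y = g y) ->
  has_dderiv f x h l -> has_dderiv g x h l.
Proof.
move=> Uo Ux fg fl; rewrite /has_dderiv.
rewrite /has_dderiv in fl; refine (cvg_trans (near_eq_cvg _) fl); near=> t.
have Ut : U (x + t *: h).
  near: t; apply: nbhs_dnbhs.
  have : (fun t : K^o => x + t *: h) @ (0 : K^o) --> x.
    rewrite -[X in _ --> X]addr0 -(scale0r h).
    apply: (@continuous2_cvg _ _ _ _ (nbhs (0 : K^o)) _ _ _ (fun u v : E => u + v)).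
    - exact: (@add_continuous E (x, 0 *: h)).
    - exact: cvg_cst.
    apply: (@continuous2_cvg _ K^o _ _ (nbhs (0 : K^o)) _ id (fun=> h) (fun s v => s *: v)) => //.
    - exact: (@scale_continuous K E (0 : K^o, h)).
    - exact: cvg_cst.
  by apply; exact: open_nbhs_nbhs.
by rewrite fg // fg.
Unshelve. all: by end_near. Qed.

Lemma class_C_congr {F : tvsType K} k (U : set E) (f g : E -> F) :
  open U -> (forall y, U y -> f y = g y) -> class_C k U f -> class_C k U g.
Proof.
move=> Uo fg.
have cont_g : (forall x, U x -> {for x, continuous f}) ->
    forall x, U x -> {for x, continuous g}.
  move=> fc x Ux; rewrite /prop_for /continuous_at -fg //.
  have fgx : {near nbhs x, f =1 g}.
    by apply: filterS (open_nbhs_nbhs (conj Uo Ux)) => y /fg.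
  exact: cvg_trans (near_eq_cvg fgx) (fc x Ux).
case: k => [|k] /=; first exact: cont_g.
move=> [fc [df dfP dfC]]; split; first exact: cont_g.
by exists df => // x h Ux; apply: (has_dderiv_congr Uo Ux fg); exact: dfP.
Qed.

End DirectionalDerivatives.

(** * Rational functions are smooth *)

Section RationalFunctions.
Context {K : numFieldType}.

(** A class of scalar functions that contains the continuous linear forms and
    is stable under directional differentiation. *)
Inductive rational_on {E : tvsType K} (U : set E) : (E -> K^o) -> Prop :=
| RatCst c : rational_on U (fun=> c)
| RatLin l : (forall (c : K) u v, l (c *: u + v) = c * l u + l v) ->
    continuous l -> rational_on U l
| RatAdd f g : rational_on U f -> rational_on U g -> rational_on U (fun x => f x + g x)
| RatMul f g : rational_on U f -> rational_on U g -> rational_on U (fun x => f x * g x)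
| RatInv f : rational_on U f -> (forall x, U x -> f x != 0) ->
    rational_on U (fun x => (f x)^-1).

Lemma rational_on_comp {E F : tvsType K} (U : set E) (V : set F) (p : E -> F) f :
  (forall c u v, p (c *: u + v) = c *: p u + p v) -> continuous p ->
  (forall x, U x -> V (p x)) ->
  rational_on V f -> rational_on U (f \o p).
Proof.
move=> pL pc pUV; elim=> {f} [c|l lL lc|f g _ IHf _ IHg|f g _ IHf _ IHg|f _ IHf f0].
- exact: RatCst.
- apply: RatLin => [c u v|x]; first by rewrite /= pL lL.
  by apply: continuous_comp; [exact: pc|exact: lc].
- exact: (RatAdd IHf IHg).
- exact: (RatMul IHf IHg).
- by apply: (RatInv IHf) => x /pUV; exact: f0.
Qed.

Lemma rational_on_continuous {E : tvsType K} (U : set E) f x :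
  rational_on U f -> U x -> {for x, continuous f}.
Proof.
move=> fR Ux; elim: fR => {f} [c|l lL lc|f g _ IHf _ IHg|f g _ IHf _ IHg|f _ IHf f0].
- exact: cvg_cst.
- exact: lc.
- exact: cvgD.
- exact: cvgM.
- by apply: cvgV => //; exact: f0.
Qed.

(** The derivative, seen as a function of the point and the direction, is again
    rational: this is the step that iterates to give every order of
    differentiability. *)
Lemma rational_on_dderiv {E : tvsType K} (U : set E) f : rational_on U f ->
  exists2 df : (E * E)%type -> K^o, rational_on (U `*` setT) df &
    forall x h, U x -> has_dderiv f x h (df (x, h)).
Proof.
have fstR g : rational_on U g -> rational_on (U `*` setT) (g \o fst : (E * E)%type -> K^o).
  by apply: rational_on_comp => [//|x|[x h] []//]; exact: cvg_fst.
elim=> {f} [c|l lL lc|f g fR [df dfR dfP] gR [dg dgR dgP]|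
  f g fR [df dfR dfP] gR [dg dgR dgP]|f fR [df dfR dfP] f0].
- by exists (fun=> 0) => [|x h _]; [exact: RatCst|exact: has_dderiv_cst].
- exists (l \o snd) => [|x h _]; last exact: has_dderiv_linear.
  apply: RatLin => [c u v|x]; first exact: lL.
  by apply: continuous_comp; [exact: cvg_snd|exact: lc].
- exists (fun p => df p + dg p) => [|x h Ux]; first exact: RatAdd.
  by apply: has_dderivD; [exact: dfP|exact: dgP].
- exists (fun p => df p * (g \o fst) p + (f \o fst) p * dg p) => [|x h Ux].
    by apply: RatAdd; apply: RatMul => //; exact: fstR.
  by apply: has_dderivM; [exact: dfP|exact: dgP].
- have gR : rational_on (U `*` setT) ((fun x => (f x)^-1) \o fst : (E * E)%type -> K^o).
    by apply: fstR; exact: RatInv.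
  exists (fun p => -1 * (df p * (((fun x => (f x)^-1) \o fst) p * ((fun x => (f x)^-1) \o fst) p))).
    by apply: RatMul; [exact: RatCst|do 2?apply: RatMul].
  by move=> x h Ux; rewrite mulN1r; apply: has_dderivV; [exact: f0|exact: dfP].
Qed.

Lemma rational_on_sum {E : tvsType K} (U : set E) (I : Type) (r : seq I) (f : I -> E -> K^o) :
  (forall i, rational_on U (f i)) -> rational_on U (fun x => \sum_(i <- r) f i x).
Proof.
move=> fR; elim: r => [|i r IH].
  rewrite (_ : (fun _ => _) = fun=> 0); first exact: RatCst.
  by apply/funext => y; rewrite big_nil.
rewrite (_ : (fun _ => _) = fun y => f i y + \sum_(j <- r) f j y); first exact: RatAdd.
by apply/funext => y; rewrite big_cons.
Qed.

Lemma rational_onX {E : tvsType K} (U : set E) f k :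
  rational_on U f -> rational_on U (fun x => f x ^+ k).
Proof.
move=> fR; elim: k => [|k IH]; first exact: RatCst.
rewrite (_ : (fun _ => _) = fun x => f x * f x ^+ k); first exact: RatMul.
by apply/funext => x; rewrite exprS.
Qed.

Lemma seqspace_dderivP {E : tvsType K} (f : E -> seqspace K) x h (l : seqspace K) :
  has_dderiv f x h l <-> forall n, has_dderiv (fun y => f y n : K^o) x h (l n).
Proof. exact: seqspace_cvgP. Qed.

Lemma seqspace_proj_continuous n : continuous (fun a : seqspace K => a n : K^o).
Proof. by move=> a; exact: ((@seqspace_cvgP K (nbhs a) a _).1 (fun P H => H) n). Qed.

(** Limits in the product topology are coordinatewise, so the derivatives of
    the coordinates assemble into the derivative of the map, and the induction
    on the order of differentiability moves from [E] to [E * E]. *)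
Lemma rational_smooth_on {E : tvsType K} (U : set E) (f : E -> seqspace K) :
  (forall n, rational_on U (fun x => f x n)) -> smooth_on U f.
Proof.
move=> fR k; elim: k E U f fR => [|k IH] E U f fR.
  by move=> x Ux; apply/seqspace_cvgP => n; exact: (rational_on_continuous (fR n) Ux).
split=> [x Ux|].
  by apply/seqspace_cvgP => n; exact: (rational_on_continuous (fR n) Ux).
have /choice[df dfP] n : exists df : (E * E)%type -> K^o, rational_on (U `*` setT) df /\
    forall x h, U x -> has_dderiv (fun y => f y n : K^o) x h (df (x, h)).
  by have [df] := rational_on_dderiv (fR n); exists df.
exists (fun p => (fun n => df n p) : seqspace K); last by apply: IH => n; case: (dfP n).
by move=> x h Ux; apply/seqspace_dderivP => n; case: (dfP n) => _; exact.
Qed.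

End RationalFunctions.

(** * Operations on power series are rational in the coefficients *)

Section Smoothness.
Context {K : numFieldType} {E : tvsType K} (U : set E).
Implicit Types F G : E -> fps K.

Local Notation rational F := (forall n, rational_on U (fun x => F x n)).

Lemma rational_on_fps_mul F G :
  rational F -> rational G -> rational (fun x => fps_mul (F x) (G x)).
Proof.
move=> FR GR n; apply: (@rational_on_sum K E U _ _ (fun (i : 'I_n.+1) x => F x i * G x (n - i)%N)).
by move=> i; apply: RatMul.
Qed.

Lemma rational_on_fps_exp F k : rational F -> rational (fun x => fps_exp (F x) k).
Proof.
move=> FR; elim: k => [|k IH]; last exact: (rational_on_fps_mul FR IH).
by move=> n; exact: RatCst.
Qed.

Lemma rational_on_fps_comp G F :
  rational G -> rational F -> rational (fun x => fps_comp (G x) (F x)).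
Proof.
move=> GR FR n.
apply: (@rational_on_sum K E U _ _ (fun (k : 'I_n.+1) x => G x k * fps_exp (F x) k n)) => k.
by apply: RatMul => //; apply: rational_on_fps_exp.
Qed.

Lemma rational_on_fps_deriv F : rational F -> rational (fun x => fps_deriv (F x)).
Proof.
move=> FR n; rewrite (_ : (fun _ => _) = fun x => F x n.+1 * n.+1%:R).
  by apply: RatMul => //; exact: RatCst.
by apply/funext => x; rewrite mulr_natr.
Qed.

(** By strong induction along the recursion, whose only denominators are powers
    of the linear coefficient. *)
Lemma rational_on_fps_linv F : (forall x, U x -> F x 1%N != 0) ->
  rational F -> rational (fun x => fps_linv (F x)).
Proof.
move=> F1 FR n; elim/ltn_ind: n => n IH.
rewrite (_ : (fun _ => _) = fun x => (fps_z n + -1 *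
   \sum_(k < n) fps_linv (F x) k * fps_exp (F x) k n) * (F x 1%N ^+ n)^-1).
  apply: RatMul.
    apply: RatAdd; first exact: RatCst.
    apply: RatMul; first exact: RatCst.
    apply: (@rational_on_sum K E U _ _ (fun (k : 'I_n) x => fps_linv (F x) k * fps_exp (F x) k n)) => k.
    by apply: RatMul; [exact: IH|apply: rational_on_fps_exp].
  apply: RatInv => [|x /F1 ?]; [exact: rational_onX|exact: expf_neq0].
by apply/funext => x; rewrite fps_linvE mulN1r.
Qed.

End Smoothness.

(** * The Lie group and its left-invariant vector fields *)

Section LeftInvariantFields.
Context {K : numFieldType}.
Local Notation G := (fps_group K).
Local Notation E := (seqspace K).
Local Notation chart := (gchart G).
Local Notation param := (gparam G).
Local Notation D := (fps_deriv : ps K -> ps K).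
Implicit Types (a u v w x : E) (f g : fps K).

Lemma chartK f : f 0%N = 0 -> param (chart f) = f.
Proof. by move=> f0; apply/funext => -[]. Qed.

Lemma paramK a : chart (param a) = a.
Proof. by apply/funext. Qed.

Lemma param_linear (c : K) u v : param (c *: u + v) = c *: param u + param v.
Proof.
by apply/funext => -[|n] //; rewrite [RHS](_ : _ = c * 0 + 0) // mulr0 addr0.
Qed.

Lemma rational_on_param {F : tvsType K} (U : set F) (p : F -> E) (n : nat) :
  (forall (c : K) (u v : F), p (c *: u + v) = c *: p u + p v) -> continuous p ->
  rational_on U (fun x : F => param (p x) n).
Proof.
move=> pL pc; case: n => [|n]; first exact: RatCst.
apply: RatLin => [c u v|x]; first by rewrite /= pL.
apply: (@continuous_comp _ _ _ p (fun a : E => a n : K^o)); first exact: pc.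
exact: seqspace_proj_continuous.
Qed.

Lemma open_gdom : open (gdom G).
Proof.
rewrite (_ : gdom G = (fun a : E => a 0%N : K^o) @^-1` (~` [set 0])).
  apply: open_comp => [a _|]; first exact: seqspace_proj_continuous.
  by rewrite openC; apply: accessible_closed_set1; apply: hausdorff_accessible; exact: norm_hausdorff.
by apply/seteqP; split=> a /eqP.
Qed.

Lemma fps_is_global_chart : is_global_chart G.
Proof.
split; first exact: open_gdom.
- by move=> f [f0 f1]; split; [exact: f1|exact: chartK].
- by move=> a a0; split; [split|exact: paramK].
Qed.

Lemma fps_is_lie_group : is_lie_group G.
Proof.
have fpsparam (U : set E) n : rational_on U (fun x => param x n).
  by apply: (@rational_on_param _ _ id) => // x; exact: cvg_id.
split; [exact: fps_is_group|exact: fps_is_global_chart| |].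
  apply: rational_smooth_on => n; apply: rational_on_fps_comp => m.
    by apply: (@rational_on_param _ _ fst) => // x; exact: cvg_fst.
  by apply: (@rational_on_param _ _ snd) => // x; exact: cvg_snd.
move=> inv invP k.
apply: (@class_C_congr _ _ _ _ _ (fun x => chart (fps_linv (param x)))).
- exact: open_gdom.
- by move=> x x0; rewrite (fps_group_inverse_uniq invP).
- apply: rational_smooth_on => n.
  by apply: (rational_on_fps_linv (F := param)).
Qed.

Lemma has_dderiv_fps_mul {F : tvsType K} (A B : F -> fps K) (x h : F) (A' B' : ps K) :
  (forall n, has_dderiv (fun y => A y n : K^o) x h (A' n)) ->
  (forall n, has_dderiv (fun y => B y n : K^o) x h (B' n)) ->
  forall n, has_dderiv (fun y => fps_mul (A y) (B y) n : K^o) x h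
    ((A' * (B x : ps K) + (A x : ps K) * B') n).
Proof.
move=> AP BP n.
rewrite [X in has_dderiv _ _ _ X](_ : _ =
  \sum_(i < n.+1) (A' i * B x (n - i)%N + A x i * B' (n - i)%N)); last exact/esym/big_split.
apply: (has_dderiv_sum (f := fun (i : 'I_n.+1) y => A y i * B y (n - i)%N)) => i.
exact: has_dderivM.
Qed.

Lemma fps_expE (f : ps K) k : fps_exp f k = f ^+ k.
Proof. by elim: k => // k IH; rewrite exprS -IH. Qed.

Lemma has_dderiv_fps_exp {F : tvsType K} (A : F -> fps K) (x h : F) (A' : ps K) k :
  (forall n, has_dderiv (fun y => A y n : K^o) x h (A' n)) ->
  forall n, has_dderiv (fun y => fps_exp (A y) k n : K^o) x h
    (((A x : ps K) ^+ k.-1 * A' *+ k) n).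
Proof.
move=> AP; elim: k => [|k IH] n; first exact: has_dderiv_cst.
rewrite (_ : _ *+ _ = A' * (fps_exp (A x) k : ps K) + (A x : ps K) * ((A x : ps K) ^+ k.-1 * A' *+ k)).
  exact: (has_dderiv_fps_mul AP IH).
rewrite fps_expE; case: k {IH} => [|k] /=; first by rewrite !mulr0n mulr0 addr0 mulrC.
by rewrite mulrS [A' * _]mulrC mulrnAr mulrA -exprS.
Qed.

(** The derivative of A^k is k A^(k-1) A', and summation against the coefficients
    of g turns the factors k A^(k-1) into g' o A. *)
Lemma has_dderiv_fps_comp {F : tvsType K} g (A : F -> fps K) (x h : F) (A' : ps K) :
  (forall y, A y 0%N = 0) ->
  (forall n, has_dderiv (fun y => A y n : K^o) x h (A' n)) ->
  forall n, has_dderiv (fun y => fps_comp g (A y) n : K^o) x h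
    (((fps_comp (D g) (A x) : ps K) * A') n).
Proof.
move=> A0 AP n.
have ps_mulrn (f : ps K) k m : (f *+ k) m = f m *+ k.
  by elim: k => // k IH; rewrite !mulrS -IH.
(* The term of index n + 1 vanishes, but its derivative is matched with the last
   term of (g' o A) A' once differentiation has shifted the indices by one. *)
rewrite (_ : (fun y => _) = fun y => \sum_(k < n.+2) g k * fps_exp (A y) k n); last first.
  by apply/funext => y; exact: fps_comp_wide.
rewrite [X in has_dderiv _ _ _ X](_ : _ =
    \sum_(k < n.+2) (0 * fps_exp (A x) k n + g k * ((A x : ps K) ^+ k.-1 * A' *+ k) n)).
  apply: (has_dderiv_sum (f := fun (k : 'I_n.+2) y => g k * fps_exp (A y) k n)) => k.
  by apply: has_dderivM; [exact: has_dderiv_cst|exact: has_dderiv_fps_exp].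
rewrite big_ord_recl /= mul0r add0r mulr0 add0r.
transitivity (\sum_(k < n.+1) \sum_(i < n.+1) D g k * fps_exp (A x) k i * A' (n - i)%N).
  rewrite exchange_big; apply: eq_bigr => i _.
  by rewrite (@fps_comp_wide _ _ _ _ n.+1) // mulr_suml.
apply: eq_bigr => k _; rewrite mul0r add0r ps_mulrn -fps_expE mulrnAr -mulrnAl.
rewrite [X in _ = _ * X]/GRing.mul /= /fps_mul mulr_sumr; apply: eq_bigr => i _.
by rewrite mulrA.
Qed.

(** Translation by g = \sum b_k z^k sends h to g o h and has differential
    k |-> (g' o h) k, so that the invariant field with value v at z must be
    h |-> h' v. It is linear in h. *)
Definition invariant_field v x : E := chart (fps_mul (fps_deriv (param x)) (param v)).

Lemma param_invariant_field v x : param (invariant_field v x) = (D (param x) * (param v : ps K)).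
Proof. by rewrite chartK // /GRing.mul /= /fps_mul big_ord1 mulr0. Qed.

(** Invariance is the chain rule: (g o h)' v = (g' o h) (h' v). *)
Lemma invariant_field_left_invariant v : left_invariant_field G (invariant_field v).
Proof.
split.
  apply: rational_smooth_on => n; apply: rational_on_fps_mul => m; last exact: RatCst.
  by apply: rational_on_fps_deriv => i; apply: (@rational_on_param _ _ id) => // y; exact: cvg_id.
move=> g x [g0 g1] x0; apply/seqspace_dderivP => n.
rewrite [X in has_dderiv _ _ _ X](_ : _ = ((fps_comp (D g) (param x) : ps K) * param (invariant_field v x)) n.+1).
  apply: has_dderiv_fps_comp => // -[|m]; first exact: has_dderiv_cst.
  by apply: (has_dderiv_linear (f := fun y : E => y m)).
by rewrite param_invariant_field mulrA -fps_deriv_comp.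
Qed.

Lemma invariant_field_one v : invariant_field v (chart fps_z) = v.
Proof.
apply/funext => n; rewrite /invariant_field chartK // (_ : fps_deriv _ = fps_one) ?fps_mul1 //.
by apply/funext => -[|m] //; rewrite /fps_deriv /fps_z /= mul0rn.
Qed.

(** Translate from the identity: both sides are the derivative of the same
    translation along the same tangent vector. *)
Lemma left_invariant_fieldE V x : left_invariant_field G V -> gdom G x ->
  V x = invariant_field (V (chart fps_z)) x.
Proof.
move=> [_ VP] x0; set e := chart fps_z.
have Se : gdom G e by exact: oner_neq0.
have Sx : gset G (param x) by [].
have Lx : left_translation G (param x) e = x.
  by rewrite /left_translation chartK // /= fps_comp_zr.
have [_ WP] := invariant_field_left_invariant (V e).
have := WP _ _ Sx Se; have := VP _ _ Sx Se; rewrite Lx invariant_field_one => H1 H2.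
apply/funext => n; move/seqspace_dderivP: H1 => /(_ n) H1.
by move/seqspace_dderivP: H2 => /(_ n); exact: has_dderiv_uniq.
Qed.

Lemma invariant_field_linear v (c : K) x y :
  invariant_field v (c *: x + y) = c *: invariant_field v x + invariant_field v y.
Proof.
apply/funext => n.
rewrite [RHS]/GRing.add /= [X in _ = X + _]/GRing.scale /=.
rewrite /invariant_field /= /fps_mul scaler_sumr -big_split; apply: eq_bigr => i _ /=.
by rewrite /fps_deriv /= mulrnDl mulrDl [(c *: x) i]/(c * x i) -mulrnAr -mulrA.
Qed.

(** The arguments are exchanged with respect to [fps_bracket]: the bracket of
    the fields h |-> h' u and h |-> h' v takes the value u' v - u v' at z. *)
Definition coord_bracket u v : E := chart (fps_bracket (param v) (param u)).

Lemma param_coord_bracket u v : param (coord_bracket u v) = fps_bracket (param v) (param u).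
Proof.
rewrite chartK // /fps_bracket [LHS]/GRing.add /= /GRing.opp /=.
by rewrite /fps_mul !big_ord1 mul0r mulr0 subrr.
Qed.

(** As invariant fields are linear, their derivatives are themselves; in
    (x' u)' v - (x' v)' u the terms with x'' cancel, leaving x' (u' v - u v'). *)
Lemma invariant_field_bracket u v x :
  invariant_field (coord_bracket u v) x =
  invariant_field v (invariant_field u x) - invariant_field u (invariant_field v x).
Proof.
rewrite [LHS]/invariant_field param_coord_bracket [in RHS]/invariant_field !param_invariant_field.
rewrite [X in _ = X - _](_ : _ = chart (D (D (param x) * (param u : ps K)) * (param v : ps K))) //.
rewrite [X in _ = _ - X](_ : _ = chart (D (D (param x) * (param v : ps K)) * (param u : ps K))) //.
rewrite !fps_derivM.
set a := D (param x); set b := D a; set pu := param u : ps K; set pv := param v : ps K.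
rewrite [LHS](_ : _ = chart (a * (pv * D pu - D pv * pu))) //.
rewrite [RHS](_ : _ = chart ((b * pu + a * D pu) * pv - (b * pv + a * D pv) * pu)) //.
have ringE (a' b' p q p' q' : ps K) : a' * (q * p' - q' * p) =
  (b' * p + a' * p') * q - (b' * q + a' * q') * p by ring.
exact: (congr1 chart (ringE a b pu pv (D pu) (D pv))).
Qed.

Lemma coord_bracket_is_lie_bracket : is_lie_bracket_of G coord_bracket.
Proof.
split=> [v|V W VP WP].
  by exists (invariant_field v); [exact: invariant_field_left_invariant|exact: invariant_field_one].
set e := chart (gone G).
exists (invariant_field (coord_bracket (V e) (W e))); split.
- exact: invariant_field_left_invariant.
- move=> x Sx; exists (invariant_field (W e) (V x)), (invariant_field (V e) (W x)).
  (* Y agrees with a linear field on an open set. *)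
  have ddV Y h : left_invariant_field G Y -> has_dderiv Y x h (invariant_field (Y e) h).
    move=> YP; apply: (has_dderiv_congr (f := invariant_field (Y e)) open_gdom Sx).
      by move=> y Sy; rewrite -left_invariant_fieldE.
    apply/seqspace_dderivP => n.
    apply: (has_dderiv_linear (f := fun y => invariant_field (Y e) y n)) => c a b.
    by rewrite invariant_field_linear.
  split; [exact: ddV|exact: ddV|].
  by rewrite invariant_field_bracket (left_invariant_fieldE VP Sx) (left_invariant_fieldE WP Sx).
- by rewrite invariant_field_one.
Qed.

End LeftInvariantFields.

(** * The Lie algebra of power series *)

Section LieAlgebras.
Context {K : numFieldType}.

Lemma lie_algebra_pullback {V W : lmodType K} (bV : V -> V -> V) (B : set W)
    (bW : W -> W -> W) :
  is_lie_algebra B bW -> lie_isomorphic bV B bW -> is_lie_algebra setT bV.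
Proof.
move=> [_ _ bilin alt jac] [phi [phiB phi_inj _] phiM].
have phiI u v : phi u = phi v -> u = v by move=> E; apply: phi_inj; rewrite ?inE.
have Bphi u : B (phi u) by exact: phiB.
split=> //.
- move=> c u v w _ _ _; have [E1 E2] := bilin c _ _ _ (Bphi u) (Bphi v) (Bphi w).
  by split; apply: phiI; rewrite phiM !linearP !phiM.
- by move=> u _; apply: phiI; rewrite phiM alt // linear0.
- by move=> u v w _ _ _; apply: phiI; rewrite !linearD !phiM jac // linear0.
Qed.

Implicit Types f g h : ps K.
Local Notation D := (fps_deriv : ps K -> ps K).

Lemma fps_bracketE f g : fps_bracket f g = f * D g - D f * g.
Proof. by []. Qed.

Lemma ps_scaleAl (c : K) f g : c *: (f * g) = (c *: f) * g.
Proof.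
apply/funext => n; rewrite [LHS]/GRing.scale /= [LHS]scaler_sumr.
by apply: eq_bigr => i _; rewrite -[LHS]/(c * _) mulrA.
Qed.

Lemma fps_derivZ (c : K) f : D (c *: f) = c *: D f.
Proof. by apply/funext => n; exact/esym/mulrnAr. Qed.

Lemma fps_bracketZDl (c : K) f g h :
  (fps_bracket (c *: f + g) h : ps K) = c *: (fps_bracket f h : ps K) + fps_bracket g h.
Proof.
rewrite !fps_bracketE fps_derivD fps_derivZ scalerBr !ps_scaleAl.
by rewrite !mulrDl opprD addrACA.
Qed.

Lemma fps_bracketC f g : (fps_bracket f g : ps K) = - (fps_bracket g f : ps K).
Proof. rewrite !fps_bracketE; ring. Qed.

(** The Jacobi identity after expansion of all derivatives by the Leibniz rule,
    with first and second derivatives replaced by independent variables. *)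
Lemma fps_jacobi_identity (f g h f' g' h' f'' g'' h'' : ps K) :
  f * (g' * h' + g * h'' - (g'' * h + g' * h')) - f' * (g * h' - g' * h) +
  (g * (h' * f' + h * f'' - (h'' * f + h' * f')) - g' * (h * f' - h' * f)) +
  (h * (f' * g' + f * g'' - (f'' * g + f' * g')) - h' * (f * g' - f' * g)) = 0.
Proof. ring. Qed.

Lemma fps_is_lie_algebra : is_lie_algebra (fps0 K) fps_bracket.
Proof.
split.
- split=> // c f g f0 g0; rewrite /fps0 /= [LHS](_ : _ = c * f 0%N + g 0%N) //.
  by rewrite f0 g0 mulr0 addr0.
- move=> f g f0 g0; rewrite /fps0 /= [LHS](_ : _ = fps_mul f (fps_deriv g) 0%N - fps_mul (fps_deriv f) g 0%N) //.
  by rewrite /fps_mul !big_ord1 f0 g0 mul0r mulr0 subrr.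
- move=> c f g h _ _ _; split; first exact: fps_bracketZDl.
  rewrite (fps_bracketC h) fps_bracketZDl opprD -scalerN.
  by rewrite -!fps_bracketC.
- by move=> f _; rewrite fps_bracketE mulrC subrr.
- move=> f g h _ _ _; rewrite !fps_bracketE !fps_derivB !fps_derivM.
  exact: fps_jacobi_identity.
Qed.

(** The sign turns the opposite bracket into the bracket itself. *)
Definition neg_param (a : seqspace K) : fps K := - gparam (fps_group K) a.

Lemma neg_param_linear : linear neg_param.
Proof. by move=> c u v; rewrite /neg_param param_linear opprD scalerN. Qed.

HB.instance Definition _ :=
  GRing.isLinear.Build K (seqspace K) (fps K) _ neg_param neg_param_linear.

Lemma coord_bracket_isomorphic : lie_isomorphic (@coord_bracket K) (fps0 K) fps_bracket.
Proof.
exists neg_param; last first.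
  move=> u v; rewrite /= /neg_param param_coord_bracket !fps_bracketE.
  set p : ps K := gparam _ u; set q : ps K := gparam _ v.
  have derivN f : D (- f) = - D f by apply/funext => n; exact: mulNrn.
  rewrite [RHS](_ : _ = (- p) * D (- q) - D (- p) * (- q)) // !derivN.
  have ringE (a b a' b' : ps K) : - (b * a' - b' * a) = (- a) * (- b') - (- a') * (- b) by ring.
  exact: ringE.
split.
- by move=> a _; rewrite /fps0 /= [LHS](_ : _ = - 0) // oppr0.
- move=> u v _ _ /oppr_inj uv; rewrite -[u]paramK uv.
  exact: paramK.
- move=> f f0; exists (gchart (fps_group K) (- f)) => //.
  rewrite [LHS](_ : _ = - gparam (fps_group K) (gchart (fps_group K) (- f))) //.
  by rewrite chartK ?opprK // [LHS](_ : _ = - f 0%N) // f0 oppr0.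
Qed.

End LieAlgebras.

Theorem proposition4p3 (R : realType) :
  is_lie_group (fps_group R[i]) /\
  is_lie_algebra (fps0 R[i]) fps_bracket /\
  exists br : seqspace R[i] -> seqspace R[i] -> seqspace R[i],
    is_lie_bracket_of (fps_group R[i]) br /\
    is_lie_algebra setT br /\
    lie_isomorphic br (fps0 R[i]) fps_bracket.
Proof.
split; first exact: fps_is_lie_group.
split; first exact: fps_is_lie_algebra.
exists (@coord_bracket R[i]); split; first exact: coord_bracket_is_lie_bracket.
split; last exact: coord_bracket_isomorphic.
exact: lie_algebra_pullback fps_is_lie_algebra coord_bracket_isomorphic.
Qed.
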